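(* Let $Z_1,\dots,Z_n$ be independent draws from an unknown $P\in\mathcal M$. Let $\psi:\mathcal M\to\mathbb R$ be real-valued and expressible as a composition of primitives $\theta_1,\dots,\theta_k$ (see context), with each $\theta_j$ totally pathwise differentiable at $(P,h_{\mathrm{pa}(j)})$, where $h_1,\dots,h_k$ are the values of the forward evaluation at $P$. Let $f_k=1$ and let $(\widehat h_k,\widehat f_0)$ be the output of the estimation algorithm described in the context. Define $$\widehat\psi:=\widehat h_k+\frac1n\sum_{i=1}^n\widehat f_0(Z_i),\qquad f_0:=\dot\psi_P^*(1),$$ $$\mathcal R_n:=\widehat h_k+\int\widehat f_0(z)\,P(dz)-\psi(P),\qquad \mathcal D_n:=\int[\widehat f_0(z)-f_0(z)]\,(P_n-P)(dz),$$ where $P_n$ is the empirical distribution of $Z_1,\dots,Z_n$ and $f_0$ is the efficient influence function of $\psi$ at $P$. If $\mathcal D_n=o_p(n^{-1/2})$ and $\mathcal R_n=o_p(n^{-1/2})$, then $\widehat\psi$ is an efficient estimator of $\psi(P)$, in the sense that $$\widehat\psi-\psi(P)=\frac1n\sum_{i=1}^n f_0(Z_i)+o_p(n^{-1/2}).$$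
   Context: All Hilbert spaces are real. $\mathcal M$ is a set of probability distributions (the model) on a measurable space $\mathcal Z$. **Tangent sets and spaces.** For $P\in\mathcal M$ and $s\in L^2(P)$, $\mathscr P(P,\mathcal M,s)$ is the collection of submodels $\{P_\epsilon:\epsilon\in[0,1]\}\subseteq\mathcal M$ with $P_{\epsilon=0}=P$ that are quadratic mean differentiable with score $s$ at $\epsilon=0$, i.e. $\int(\sqrt{dP_\epsilon}-\sqrt{dP}-\tfrac{\epsilon}{2}s\sqrt{dP})^2=o(\epsilon^2)$. The tangent set is $\check{\mathcal M}_P=\{s\in L^2(P):\mathscr P(P,\mathcal M,s)\neq\emptyset\}$ and the tangent space $\dot{\mathcal M}_P$ is the $L^2(P)$-closure of its linear span. For a subset $\mathcal U$ of a Hilbert space $\mathcal T$, $u\in\mathcal U$, $t\in\mathcal T$, $\mathscr P(u,\mathcal U,t)$ is the set of paths $\{u_\epsilon:\epsilon\in[0,1]\}\subseteq\mathcal U$ with $\|u_\epsilon-u-\epsilon t\|_{\mathcal T}=o(\epsilon)$; $\check{\mathcal U}_u=\{t\in\mathcal T:\mathscr P(u,\mathcal U,t)\ne\emptyset\}$ and $\dot{\mathcal U}_u$ is the $\mathcal T$-closure of its linear span. **Total pathwise differentiability.** A map $\theta:\mathcal M\times\mathcal U\to\mathcal V$, with $\mathcal U\subseteq\mathcal T$ and $\mathcal V\subseteq\mathcal W$ for ambient Hilbert spaces $\mathcal T,\mathcal W$, is totally pathwise differentiable at $(P,u)$ if there is a continuous linear $\dot\theta_{P,u}:\dot{\mathcal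 M}_P\oplus\dot{\mathcal U}_u\to\mathcal W$ such that for all $s\in\check{\mathcal M}_P$, $t\in\check{\mathcal U}_u$, $\{P_\epsilon\}\in\mathscr P(P,\mathcal M,s)$, $\{u_\epsilon\}\in\mathscr P(u,\mathcal U,t)$, $\|\theta(P_\epsilon,u_\epsilon)-\theta(P,u)-\epsilon\,\dot\theta_{P,u}(s,t)\|_{\mathcal W}=o(\epsilon)$. Its Hermitian adjoint is $\dot\theta_{P,u}^*:\mathcal W\to\dot{\mathcal M}_P\oplus\dot{\mathcal U}_u$. **Pathwise differentiability.** $\psi:\mathcal M\to\mathbb R$ is pathwise differentiable at $P$ if there is a continuous linear $\dot\psi_P:\dot{\mathcal M}_P\to\mathbb R$ with $\psi(P_\epsilon)-\psi(P)-\epsilon\,\dot\psi_P(s)=o(\epsilon)$ for all $s\in\check{\mathcal M}_P$ and $\{P_\epsilon\}\in\mathscr P(P,\mathcal M,s)$. Its efficient influence operator is the adjoint $\dot\psi_P^*:\mathbb R\to\dot{\mathcal M}_P$ and its efficient influence function (EIF) is $\dot\psi_P^*(1)$. (Under the theorem's hypotheses on the primitives, $\psi$ is pathwise differentiable at $P$.) **Forward evaluation.** For each $j\in[k]:=\{1,\dots,k\}$ there are: an index set $\mathrm{pa}(j)\subseteq\{1,\dots,j-1\}$; a set $\mathcal V_j$ contained in a Hilbert space $\mathcal W_j$, with $\mathcal W_k=\mathbb R$; a set $\mathcal U_j\supseteq\prod_{i\in\mathrm{pa}(j)}\mathcal V_i$ contained in $\bigoplus_{i\in\mathrm{pa}(j)}\mathcal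 W_i$ ($\mathcal U_j=\{0\}$ if $\mathrm{pa}(j)=\emptyset$); and a primitive $\theta_j:\mathcal M\times\mathcal U_j\to\mathcal V_j$, with ambient spaces $\bigoplus_{i\in\mathrm{pa}(j)}\mathcal W_i$ and $\mathcal W_j$. For a tuple $(a_i)$ and index set $\mathcal S$, $a_{\mathcal S}:=(a_i:i\in\mathcal S)$, $a_\emptyset:=0$. Given $P'\in\mathcal M$, the forward evaluation computes $h_j=\theta_j(P',h_{\mathrm{pa}(j)})$ for $j=1,\dots,k$ and returns $h_k$. ''$\psi$ is expressible as a composition of the primitives'' means that for every $P'\in\mathcal M$ the forward evaluation with input $P'$ returns $\psi(P')$. **Estimation algorithm.** Input: $f_k$ and data $\{Z_i:i\in\mathscr I\}$, $\mathscr I\subseteq\{1,\dots,n\}$, used for all the (otherwise arbitrary) nuisance estimation below. Forward pass: for $j=1,\dots,k$, let $\widehat h_j$ be an estimate of $\theta_j(P,\widehat h_{\mathrm{pa}(j)})$. Backward pass: initialize $\widehat f_0$ as the zero function on $\mathcal Z$, $\widehat f_1,\dots,\widehat f_{k-1}$ as the zero elements of $\mathcal W_1,\dots,\mathcal W_{k-1}$, and $\widehat f_k=f_k$; for $j=k,k-1,\dots,1$, let $\widehat\vartheta_j$ be an estimate of $\dot\theta^*_{j,P,\widehat h_{\mathrm{pa}(j)}}(\widehat f_j)$ whose first entry $\widehat\vartheta_{j,0}$ (a real function on $\mathcal Z$) is compatible with $\widehat h_j,\widehat h_{\mathrm{pa}(j)}$, meaning that there exists $\widehat P_j\in\mathcal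 M$ with $\widehat h_j=\theta_j(\widehat P_j,\widehat h_{\mathrm{pa}(j)})$ and $\int\widehat\vartheta_{j,0}\,d\widehat P_j=0$; then replace $(\widehat f_0,\widehat f_{\mathrm{pa}(j)})$ by $(\widehat f_0,\widehat f_{\mathrm{pa}(j)})+\widehat\vartheta_j$. Output: $\widehat h_k$ and $\widehat f_0$. *)

(* Defs.v *)
From HB Require Import structures.
From mathcomp Require Import all_boot all_order all_algebra.
From mathcomp Require Import all_classical all_reals all_analysis.
From mathcomp Require Import ring lra.

Set Implicit Arguments.
Unset Strict Implicit.
Unset Printing Implicit Defensive.
Import Order.TTheory GRing.Theory Num.Theory.
Import numFieldNormedType.Exports.

Local Open Scope classical_set_scope.
Local Open Scope ring_scope.

(** * Real Hilbert spaces *)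

HB.mixin Record isHilbert (R : realType) V & CompleteNormedModule R V := {
  hdot : V -> V -> R;
  hdotC : forall x y, hdot x y = hdot y x;
  hdotPl : forall (a : R) x y z, hdot (a *: x + y) z = a * hdot x z + hdot y z;
  hdotxx : forall x, hdot x x = `|x| ^+ 2
}.

#[short(type="hilbertType")]
HB.structure Definition Hilbert (R : realType) :=
  {V of CompleteNormedModule R V & isHilbert R V}.

Section real_line.
Variable R : realType.

Fact real_dotC (x y : R) : x * y = y * x. Proof. exact: mulrC. Qed.
Fact real_dotPl (a x y z : R) : (a *: x + y) * z = a * (x * z) + y * z.
Proof. by rewrite mulrDl mulrA. Qed.
Fact real_dotxx (x : R) : x * x = `|x| ^+ 2.
Proof. by rewrite -normrX ger0_norm ?sqr_ge0// expr2. Qed.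

HB.instance Definition _ := isHilbert.Build R R^o real_dotC real_dotPl real_dotxx.
End real_line.

Section direct_sum.
Variables (R : realType) (I : finType) (W : I -> hilbertType R).

Definition dsum : Type := forall i, W i.

HB.instance Definition _ := gen_eqMixin dsum.
HB.instance Definition _ := gen_choiceMixin dsum.

Definition dsum_add (x y : dsum) : dsum := fun i => x i + y i.
Definition dsum_opp (x : dsum) : dsum := fun i => - x i.
Definition dsum_scale (a : R) (x : dsum) : dsum := fun i => a *: x i.
Fact dsum_addA : associative dsum_add.
Proof. by move=> x y z; apply: functional_extensionality_dep => i; exact: addrA. Qed.
Fact dsum_addC : commutative dsum_add.
Proof. by move=> x y; apply: functional_extensionality_dep => i; exact: addrC. Qed.
Fact dsum_add0 : left_id ((fun=> 0) : dsum) dsum_add.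
Proof. by move=> x; apply: functional_extensionality_dep => i; exact: add0r. Qed.
Fact dsum_addN : left_inverse ((fun=> 0) : dsum) dsum_opp dsum_add.
Proof. by move=> x; apply: functional_extensionality_dep => i; exact: addNr. Qed.

HB.instance Definition _ :=
  GRing.isZmodule.Build dsum dsum_addA dsum_addC dsum_add0 dsum_addN.

Fact dsum_scaleA a b x : dsum_scale a (dsum_scale b x) = dsum_scale (a * b) x.
Proof. by apply: functional_extensionality_dep => i; exact: scalerA. Qed.
Fact dsum_scale1 : left_id 1 dsum_scale.
Proof. by move=> x; apply: functional_extensionality_dep => i; exact: scale1r. Qed.
Fact dsum_scaleDr : right_distributive dsum_scale +%R.
Proof. by move=> a x y; apply: functional_extensionality_dep => i; exact: scalerDr. Qed.
Fact dsum_scaleDl x : {morph dsum_scale^~ x : a b / a + b}.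
Proof. by move=> a b; apply: functional_extensionality_dep => i; exact: scalerDl. Qed.

HB.instance Definition _ :=
  GRing.Zmodule_isLmodule.Build R dsum dsum_scaleA dsum_scale1 dsum_scaleDr dsum_scaleDl.

Definition dsum_dot (x y : dsum) : R := \sum_i hdot (x i) (y i).
Definition dsum_norm (x : dsum) : R := Num.sqrt (\sum_i `|x i| ^+ 2).

Fact dsum_dotC x y : dsum_dot x y = dsum_dot y x.
Proof. by apply: eq_bigr => i _; exact: hdotC. Qed.
Fact dsum_dotPl (a : R) (x y z : dsum) :
  dsum_dot (a *: x + y) z = a * dsum_dot x z + dsum_dot y z.
Proof.
rewrite /dsum_dot mulr_sumr -big_split; apply: eq_bigr => i _.
exact: hdotPl.
Qed.
Fact dsum_dotxx x : dsum_dot x x = dsum_norm x ^+ 2.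
Proof.
rewrite /dsum_norm sqr_sqrtr; last by apply: sumr_ge0 => i _; exact: sqr_ge0.
by apply: eq_bigr => i _; exact: hdotxx.
Qed.
Fact dsum_norm_ge0 x : 0 <= dsum_norm x. Proof. exact: sqrtr_ge0. Qed.
#[local] Hint Resolve dsum_norm_ge0 : core.
Fact le_dsum_norm x i : `|x i| <= dsum_norm x.
Proof.
rewrite -(@ler_pXn2r _ 2)// ?nnegrE//.
rewrite sqr_sqrtr; last by apply: sumr_ge0 => j _; exact: sqr_ge0.
by rewrite (bigD1 i)//= lerDl; apply: sumr_ge0 => j _; exact: sqr_ge0.
Qed.
Fact dsum_normZ (a : R) x : dsum_norm (a *: x) = `|a| * dsum_norm x.
Proof.
rewrite /dsum_norm -[in RHS]sqrtr_sqr -sqrtrM ?sqr_ge0// mulr_sumr.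
congr (Num.sqrt _); apply: eq_bigr => i _.
by rewrite [(a *: x) i]/(a *: x i) normrZ exprMn real_normK ?num_real.
Qed.
Fact dsum_norm0_eq0 x : dsum_norm x = 0 -> x = 0.
Proof.
move=> x0; apply: functional_extensionality_dep => i.
by apply/normr0_eq0/eqP; rewrite eq_le normr_ge0 andbT -x0 le_dsum_norm.
Qed.
Fact dsum_dotDl (x y z : dsum) : dsum_dot (x + y) z = dsum_dot x z + dsum_dot y z.
Proof. by have := dsum_dotPl 1 x y z; rewrite scale1r mul1r. Qed.
Fact dsum_dotZl a (x z : dsum) : dsum_dot (a *: x) z = a * dsum_dot x z.
Proof.
have d0 : dsum_dot 0 z = 0.
  by apply/(addrI (dsum_dot 0 z)); rewrite -dsum_dotDl !addr0.
by have := dsum_dotPl a x 0 z; rewrite addr0 d0 addr0.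
Qed.
Fact dsum_dot0l z : dsum_dot 0 z = 0.
Proof. by rewrite -(scale0r 0) dsum_dotZl mul0r. Qed.
Fact dsum_cauchy_schwarz x y : dsum_dot x y <= dsum_norm x * dsum_norm y.
Proof.
have [x0|x0] := eqVneq (dsum_norm x) 0.
  by rewrite (dsum_norm0_eq0 x0) dsum_dot0l mulr_ge0.
have [y0|y0] := eqVneq (dsum_norm y) 0.
  by rewrite (dsum_norm0_eq0 y0) dsum_dotC dsum_dot0l mulr_ge0.
set a := dsum_norm x in x0 *; set b := dsum_norm y in y0 *.
have a0 : 0 < a by rewrite lt_neqAle eq_sym x0 dsum_norm_ge0.
have b0 : 0 < b by rewrite lt_neqAle eq_sym y0 dsum_norm_ge0.
have : 0 <= dsum_dot (b *: x + (- a) *: y) (b *: x + (- a) *: y).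
  by rewrite dsum_dotxx sqr_ge0.
rewrite dsum_dotDl !dsum_dotZl ![dsum_dot _ (_ + _)]dsum_dotC.
rewrite !dsum_dotDl !dsum_dotZl !dsum_dotxx.
rewrite -/a -/b (dsum_dotC y x); set c := dsum_dot x y.
have -> : b * (b * a ^+ 2 + - a * c) + - a * (b * c + - a * b ^+ 2) =
          (a * b) * ((a * b - c) *+ 2) by ring.
by rewrite pmulr_rge0 ?mulr_gt0// pmulrn_lge0// subr_ge0.
Qed.
Fact dsum_normD x y : dsum_norm (x + y) <= dsum_norm x + dsum_norm y.
Proof.
rewrite -(@ler_pXn2r _ 2)// ?nnegrE ?addr_ge0//.
rewrite -dsum_dotxx dsum_dotDl ![dsum_dot _ (_ + _)]dsum_dotC.
rewrite !dsum_dotDl !dsum_dotxx (dsum_dotC y x).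
by have := dsum_cauchy_schwarz x y; rewrite sqrrD; lra.
Qed.

HB.instance Definition _ :=
  Lmodule_isNormed.Build R dsum dsum_normD dsum_normZ dsum_norm0_eq0.

Fact dsum_complete (F : set_system dsum) : ProperFilter F -> cauchy F -> cvg F.
Proof.
move=> FF /cauchyP Fc.
have Fci i : cvg ((fun x : dsum => x i) @ F).
  apply: cauchy_cvg; apply/cauchyP => e e0.
  have [x Fx] := Fc _ e0; exists (x i); rewrite /nbhs/=.
  apply: filterS Fx => y /=; rewrite -!ball_normE /ball_ /=.
  by apply: le_lt_trans; exact: le_dsum_norm (x - y) i.
apply/cvg_ex; exists (fun i => lim ((fun x : dsum => x i) @ F)).
apply/cvgrPdist_lt => e e0.
pose d := Num.sqrt (e ^+ 2 / (#|I|.+1)%:R).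
have d0 : 0 < d by rewrite sqrtr_gt0 divr_gt0// exprn_gt0.
have near_i : \forall x \near F, forall i,
    `|lim ((fun y : dsum => y i) @ F) - x i| < d.
  by apply: filter_forall => i; move/cvgrPdist_lt : (Fci i) => /(_ _ d0).
apply: filterS near_i => x xd.
rewrite -(@ltr_pXn2r _ 2)// ?nnegrE// ?ltW//.
rewrite /Num.norm/= sqr_sqrtr; last by apply: sumr_ge0 => i _; exact: sqr_ge0.
apply: (@le_lt_trans _ _ (\sum_(i : I) d ^+ 2)).
  by apply: ler_sum => i _; rewrite ler_pXn2r ?nnegrE// ltW.
rewrite sumr_const sqr_sqrtr; last by rewrite ltW// divr_gt0// exprn_gt0.
rewrite -[ltLHS]mulr_natr mulrAC ltr_pdivrMr// ltr_pM2l ?exprn_gt0//.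
by rewrite ltr_nat.
Qed.

HB.instance Definition _ := Uniform_isComplete.Build dsum dsum_complete.
HB.instance Definition _ := isHilbert.Build R dsum dsum_dotC dsum_dotPl dsum_dotxx.

End direct_sum.

(** * Tangent sets, tangent spaces and paths *)

Section linear_span.
Variables (R : realType) (E : lmodType R).

Definition lspan (A : set E) : set E :=
  [set v | exists (n : nat) (a : 'I_n -> R) (x : 'I_n -> E),
    (forall i, A (x i)) /\ v = \sum_i a i *: x i].

End linear_span.

Section hilbert_tangent.
Variables (R : realType) (T : hilbertType R) (U : set T).

Definition path_in (u t : T) : set (R -> T) :=
  [set ue | (forall e : R, 0 <= e <= 1 -> U (ue e)) /\
    (fun e : R => ue e - u - e *: t) =o_ (0^'+) (fun e : R => e : R^o)].

Definition tangent_set (u : T) : set T := [set t | path_in u t !=set0].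

Definition tangent_space (u : T) : set T := closure (lspan (tangent_set u)).

End hilbert_tangent.

(* Elements of L^2(P) are handled through their representatives, that is,
   measurable functions with finite norm; [L2norm] is a seminorm on them. *)
Section L2.
Context {d} {Z : measurableType d} {R : realType}.
Variable P : probability Z R.

Definition L2 := LfunType P (lee1n 2).
Definition L2norm (f : L2) : R := fine ('N[P]_2%:E[EFin \o f])%E.
Definition L2dot (f g : L2) : R := \int[P]_z (f z * g z).
Definition L2closure (A : set L2) : set L2 :=
  [set f | forall e : R, 0 < e -> exists2 g, A g & L2norm (f - g) < e].

End L2.

Section quadratic_mean_differentiability.
Context {d} {Z : measurableType d} {R : realType}.

Fact measure_add_fin (P Q : probability Z R) : fin_num_fun (measure_add P Q).
Proof.
move=> A mA; rewrite measure_addE fin_numD.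
by rewrite !fin_num_measure.
Qed.
HB.instance Definition _ (P Q : probability Z R) :=
  Measure.copy (measure_add P Q)
    (msum (fun n => if n is 0%N then P : {measure set Z -> \bar R} else Q) 2).
HB.instance Definition _ (P Q : probability Z R) :=
  Measure_isFinite.Build _ _ _ (measure_add P Q) (measure_add_fin P Q).

Definition sqrt_density (mu : {sigma_finite_measure set Z -> \bar R})
    (Q : probability Z R) (z : Z) : R :=
  Num.sqrt (fine (Radon_Nikodym (charge_of_finite_measure Q) mu z)).

(* The integral of (sqrt dQ - sqrt dP - (e/2) s sqrt dP)^2 does not depend on
   the measure dominating P and Q; here it is computed with P + Q. *)
Definition qmd_remainder (P Q : probability Z R) (s : L2 P) (e : R) : R :=
  let q := sqrt_density (measure_add P Q) Q in
  let p := sqrt_density (measure_add P Q) P in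
  \int[measure_add P Q]_z (q z - p z - e / 2 * s z * p z) ^+ 2.

Variables (M : set (probability Z R)) (P : probability Z R).

Definition submodel (s : L2 P) : set (R -> probability Z R) :=
  [set Pe | [/\ forall e : R, 0 <= e <= 1 -> M (Pe e),
    Pe 0 = P &
    (fun e : R => qmd_remainder (Pe e) s e : R^o)
      =o_ (0^'+) (fun e : R => e ^+ 2 : R^o)]].

Definition model_tangent_set : set (L2 P) := [set s | submodel s !=set0].

Definition model_tangent_space : set (L2 P) :=
  L2closure (lspan model_tangent_set).

End quadratic_mean_differentiability.
Arguments submodel {d Z R} M {P} s.
Arguments model_tangent_set {d Z R} M P.
Arguments model_tangent_space {d Z R} M P.

(** * Differentiability *)

Section differentiability.
Context {d} {Z : measurableType d} {R : realType}.
Variables (M : set (probability Z R)) (P : probability Z R).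

Definition linear_continuous_on (T W : hilbertType R) (A : set (L2 P))
    (B : set T) (f : L2 P -> T -> W) : Prop :=
  (forall (a : R) s s' t t', A s -> A s' -> B t -> B t' ->
     f (a *: s + s') (a *: t + t') = a *: f s t + f s' t') /\
  (forall s t, A s -> B t -> forall e : R, 0 < e -> exists2 r : R, 0 < r &
     forall s' t', A s' -> B t' -> L2norm (s' - s) < r -> `|t' - t| < r ->
       `|f s' t' - f s t| < e).

Definition totally_pathwise_differentiable (T W : hilbertType R) (U : set T)
    (theta : probability Z R -> T -> W) (u : T) : Prop :=
  exists dtheta : L2 P -> T -> W,
    linear_continuous_on (model_tangent_space M P) (tangent_space U u) dtheta /\
    forall s t, model_tangent_set M P s -> tangent_set U u t ->
      forall Pe ue, submodel M s Pe -> path_in U u t ue ->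
        (fun e : R => theta (Pe e) (ue e) - theta P u - e *: dtheta s t)
          =o_ (0^'+) (fun e : R => e : R^o).

Variable psi : probability Z R -> R.

Definition pathwise_derivative (dpsi : L2 P -> R) : Prop :=
  [/\ forall (a : R) s s', model_tangent_space M P s ->
        model_tangent_space M P s' -> dpsi (a *: s + s') = a * dpsi s + dpsi s',
      forall s, model_tangent_space M P s -> forall e : R, 0 < e ->
        exists2 r : R, 0 < r & forall s', model_tangent_space M P s' ->
          L2norm (s' - s) < r -> `|dpsi s' - dpsi s| < e &
      forall s, model_tangent_set M P s -> forall Pe, submodel M s Pe ->
        (fun e : R => psi (Pe e) - psi P - e * dpsi s : R^o)
          =o_ (0^'+) (fun e : R => e : R^o)].

Definition pathwise_differentiable : Prop := exists dpsi, pathwise_derivative dpsi.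

Definition hermitian_adjoint (dpsi : L2 P -> R) (adj : R -> L2 P) : Prop :=
  (forall a, model_tangent_space M P (adj a)) /\
  (forall a s, model_tangent_space M P s -> L2dot (adj a) s = a * dpsi s).

(* The efficient influence function is determined up to P-a.e. equality. *)
Definition efficient_influence_function (f0 : L2 P) : Prop :=
  exists dpsi adj, [/\ pathwise_derivative dpsi, hermitian_adjoint dpsi adj &
    f0 = adj 1].

End differentiability.

(** * Forward evaluation and the estimation algorithm *)

(* With k = m + 1, [Some i] is the node i + 1 < k and [None] is the last node k,
   whose ambient space is the real line. Parents precede their children, so that
   they are indexed by 'I_m. *)
Definition node (m : nat) := option 'I_m.

Section computation_graph.
Variables (R : realType) (m : nat) (W : 'I_m -> hilbertType R).

Definition ambient (j : node m) : hilbertType R :=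
  if j is Some i then W i else R^o.

Definition nodes : seq (node m) := rcons [seq Some i | i <- enum 'I_m] None.

Definition parent_sum (S : {set 'I_m}) : hilbertType R :=
  dsum (fun i : {i | i \in S} => W (val i)).

(* a_S := (a_i : i in S) *)
Definition restr (a : forall j, ambient j) (S : {set 'I_m}) : parent_sum S :=
  fun i => a (Some (val i)).
Arguments restr a S : clear implicits.

(* (a_S, a_{~ S}) |-> (a_S + t, a_{~ S}) *)
Definition add_on (S : {set 'I_m}) (a : forall j, ambient j) (t : parent_sum S) :
    forall j, ambient j :=
  fun j => match j return ambient j -> ambient j with
    | Some i => fun x =>
        match @idP (i \in S) with
        | ReflectT iS => x + t (exist _ i iS)
        | ReflectF _ => x
        end
    | None => id
    end (a j).
Arguments add_on {S} a t j.

Variable pa : node m -> {set 'I_m}.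

(* The loop: for j = 1, ..., k do h_j := step j h_{pa(j)}. *)
Definition forward_pass (step : forall j, parent_sum (pa j) -> ambient j) :
    forall j, ambient j :=
  foldl (fun h j => eqtype.dfwith h (step j (restr h (pa j)))) (fun=> 0) nodes.

Definition forward_evaluation d (Z : measurableType d)
    (theta : forall j, probability Z R -> parent_sum (pa j) -> ambient j)
    (P : probability Z R) : forall j, ambient j :=
  forward_pass (fun j => theta j P).

(* The loop: for j = k, ..., 1 do
   (f_0, f_{pa(j)}) := (f_0, f_{pa(j)}) + vartheta_j with
   vartheta_j = step j f_j, starting from f_k = fk and zeros elsewhere.
   The entry f_j is not modified anymore once the node j is processed. *)
Definition backward_pass (Z : Type) (fk : R)
    (step : forall j, ambient j -> (Z -> R) * parent_sum (pa j)) :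
    (Z -> R) * (forall j, ambient j) :=
  foldl (fun f j => let v := step j (f.2 j) in
           (fun z => f.1 z + v.1 z, add_on f.2 v.2))
    (fun=> 0, @eqtype.dfwith (node m) ambient (fun=> 0) None fk) (rev nodes).

End computation_graph.
Arguments restr {R m W} a S.
Arguments add_on {R m W S} a t j.

(** * Sampling *)

Section sampling.
Context {d} {Z : measurableType d} {dO} {Omega : measurableType dO}
  {R : realType}.
Variable Pr : probability Omega R.

Definition independent_draws (P : probability Z R) (X : nat -> Omega -> Z) :
    Prop :=
  [/\ forall i, measurable_fun setT (X i),
      forall i A, measurable A -> Pr (X i @^-1` A) = P A &
      forall (s : seq nat) (A : nat -> set Z), uniq s ->
        (forall i, measurable (A i)) ->
        Pr (\bigcap_(i in [set` s]) (X i @^-1` A i)) =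
          (\prod_(i <- s) Pr (X i @^-1` A i))%E].

Definition empirical (X : nat -> Omega -> Z) (n : nat) (w : Omega) :
    {measure set Z -> \bar R} :=
  mscale (n%:R^-1)%:nng (msum (fun i => \d_(X i w)) n).

(* The outer probability agrees with the probability on measurable sets; no
   measurability in the sample is required from the estimators. *)
Definition little_op (X : nat -> Omega -> R) (r : nat -> R) : Prop :=
  forall e : R, 0 < e ->
    mu_ext Pr [set w | e * r n < `|X n w|] @[n --> \oo] --> (0%E : \bar R).

End sampling.

Definition compatible d (Z : measurableType d) (R : realType)
    (M : set (probability Z R)) (T W : Type) (theta : probability Z R -> T -> W)
    (v0 : Z -> R) (hj : W) (hpa : T) : Prop :=
  exists Q : probability Z R, [/\ M Q, hj = theta Q hpa,
    Q.-integrable setT (EFin \o v0) & \int[Q]_z v0 z = 0].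

(* Main.v *)
(* Differentiability of psi is a chain rule along the graph: running the forward
   pass on the derivatives of the primitives yields the derivative of psi.

   The remainder in the conclusion is R_n + D_n as soon as P f_0 = 0, which holds
   because f_0 is an L^2(P)-limit of linear combinations of scores, and scores of
   quadratic mean differentiable submodels have mean zero. No P-integrability of
   \hat f_0 is needed: if it fails, the integrals of \hat f_0 and \hat f_0 - f_0
   are both 0 by convention and cancel. *)

Require Import Defs.
From mathcomp Require Import all_boot all_order all_algebra.
From mathcomp Require Import all_classical all_reals all_analysis.
From mathcomp Require Import measurable_realfun.
From mathcomp Require Import ring lra.

Set Implicit Arguments.
Unset Strict Implicit.
Unset Printing Implicit Defensive.
Import Order.TTheory GRing.Theory Num.Theory.
Import numFieldNormedType.Exports.

Local Open Scope classical_set_scope.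
Local Open Scope ring_scope.

(** * The computation graph and its forward and backward passes *)

Section computation_graph.
Variables (R : realType) (m : nat) (W : 'I_m -> hilbertType R).
Variable pa : node m -> {set 'I_m}.
Hypothesis pa_lt : forall i j : 'I_m, j \in pa (Some i) -> (j < i)%N.

(** Strong induction on the ordinal settles the nodes [Some i]. The node [None] comes last, since
    every parent has the form [Some i]. *)
Lemma node_ind (Q : node m -> Prop) :
  (forall j, (forall i, i \in pa j -> Q (Some i)) -> Q j) -> forall j, Q j.
Proof.
move=> QS; have QSome : forall i, Q (Some i).
  suff QN n (i : 'I_m) : (i < n)%N -> Q (Some i) by move=> i; exact: QN (ltn_ord i).
  elim: n i => [//|n IHn] i; rewrite ltnS => i_le_n.
  by apply: QS => j /pa_lt ji; apply: IHn; exact: leq_trans ji i_le_n.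
by move=> [i|]; [exact: QSome|apply: QS => i _; exact: QSome].
Qed.

(** The order in which both passes see the graph: [nodes] is sorted for it, and parents lie strictly
    below their children. *)
Definition node_lt (i j : node m) : bool :=
  match i, j with
  | Some i, Some j => (i < j)%N
  | Some _, None => true
  | None, _ => false
  end.

Lemma node_ltxx j : node_lt j j = false.
Proof. by case: j => //= i; rewrite ltnn. Qed.

Lemma node_lt_asym i j : node_lt i j -> node_lt j i = false.
Proof. by case: i j => [i|] [j|] //= ij; apply/negbTE; rewrite -leqNgt ltnW. Qed.

Lemma pa_node_lt i j : i \in pa j -> node_lt (Some i) j.
Proof. by case: j => // j; exact: pa_lt. Qed.

Lemma nodes_sorted : pairwise node_lt (nodes m).
Proof.
rewrite /nodes pairwise_rcons; apply/andP; split.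
  by apply/allP => j /mapP[i _ ->].
rewrite pairwise_map -(@pairwise_map _ _ val ltn).
by rewrite val_enum_ord -sorted_pairwise ?iota_ltn_sorted//; exact: ltn_trans.
Qed.

Lemma mem_nodes j : j \in nodes m.
Proof.
rewrite /nodes mem_rcons inE; case: j => [i|//]; apply/orP; right.
by apply/mapP; exists i; rewrite ?mem_enum.
Qed.

Lemma nodes_split j : exists s1 s2, [/\ nodes m = s1 ++ j :: s2,
  forall i, i \in s1 -> node_lt i j & forall i, i \in s2 -> node_lt j i].
Proof.
have [s1 [s2 E]] : exists s1 s2, nodes m = s1 ++ j :: s2.
  by case/splitPr: (mem_nodes j) => s1 s2; exists s1, s2.
exists s1, s2; move: nodes_sorted; rewrite E pairwise_cat pairwise_cons.
rewrite allrel_consr => /and3P[/andP[/allP s1j _] _ /andP[/allP js2 _]].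
by split=> // i => [/s1j|/js2].
Qed.

Lemma foldl_dfwith_notin (step : forall j, parent_sum W (pa j) -> ambient W j)
    (s : seq (node m)) h j : j \notin s ->
  foldl (fun h i => eqtype.dfwith h (step i (restr h (pa i)))) h s j = h j.
Proof.
elim: s h => //= i s IHs h; rewrite inE negb_or => /andP[ji js].
by rewrite IHs// dfwith_out// eq_sym.
Qed.

Lemma eq_restr (a b : forall j, ambient W j) (S : {set 'I_m}) :
  (forall i, i \in S -> a (Some i) = b (Some i)) -> restr a S = restr b S.
Proof.
by move=> ab; apply: functional_extensionality_dep => -[i iS]; exact: ab.
Qed.

(** The loop writes entry j exactly once. The parents of j were written before that moment and are
    not overwritten later, so the final values satisfy the recursion. *)
Lemma forward_passE (step : forall j, parent_sum W (pa j) -> ambient W j) j :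
  forward_pass step j = step j (restr (forward_pass step) (pa j)).
Proof.
have [s1 [s2 [E s1j js2]]] := nodes_split j.
rewrite /forward_pass E foldl_cat/=; set h := foldl _ _ s1.
have js2N : j \notin s2 by apply/negP => /js2; rewrite node_ltxx.
rewrite foldl_dfwith_notin// dfwith_in; congr (step j _).
apply: eq_restr => i /pa_node_lt ij; rewrite foldl_dfwith_notin.
  by rewrite dfwith_out//; apply: contraTneq ij => <-; rewrite node_ltxx.
by apply/negP => /js2 /node_lt_asym; rewrite ij.
Qed.

(** Processing a node changes only the entries of its parents; [None] is nobody's parent, so its
    entry is never changed. *)
Lemma foldl_add_on_notin (Z : Type)
    (step : forall j, ambient W j -> (Z -> R) * parent_sum W (pa j))
    (s : seq (node m)) f j :
  (forall i, i \in s -> if j is Some j' then j' \notin pa i else true) ->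
  (foldl (fun f i => let v := step i (f.2 i) in
     (fun z => f.1 z + v.1 z, add_on f.2 v.2)) f s).2 j = f.2 j.
Proof.
elim: s f => //= i s IHs f sP; rewrite IHs; last first.
  by move=> k ks; apply: sP; rewrite inE ks orbT.
rewrite /= /add_on; case: j sP {IHs} => // j /(_ i (mem_head _ _)) jiN.
by case: {-}_ / idP => [ji|//]; exfalso; rewrite ji in jiN.
Qed.

(* The entry f_j read when node j is processed is its final value. *)
Lemma backward_pass_ind (Z : Type) (Q : (Z -> R) -> Prop) (fk : R)
    (step : forall j, ambient W j -> (Z -> R) * parent_sum W (pa j)) :
  Q (fun=> 0) -> (forall f g, Q f -> Q g -> Q (fun z => f z + g z)) ->
  (forall j, Q (step j ((backward_pass fk step).2 j)).1) ->
  Q (backward_pass fk step).1.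
Proof.
move=> Q0 QD; rewrite /backward_pass; set f0 := (_, eqtype.dfwith _ _).
set upd := fun (f : (Z -> R) * (forall j, ambient W j)) _ => _.
move=> Qstep; suff Qpre s t : rev (nodes m) = s ++ t -> Q (foldl upd f0 s).1.
  by apply: (Qpre _ [::]); rewrite cats0.
elim/last_ind: s t => [//|s j IHs] t E.
have {}E : rev (nodes m) = s ++ j :: t by rewrite E cat_rcons.
rewrite foldl_rcons /=; apply: QD; first exact: IHs E.
suff -> : (foldl upd f0 s).2 j = (foldl upd f0 (rev (nodes m))).2 j by exact: Qstep.
rewrite E foldl_cat [RHS]foldl_add_on_notin// => i ijt; case: j E ijt => // j E ijt.
apply/negP => /pa_node_lt ji; have : node_lt (Some j) (Some j).
  move: ijt; rewrite inE => /predU1P[i_j|it]; first by rewrite -{2}i_j.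
  (* Undoing the reversal, [t] consists of nodes that precede j, whereas a node having j as a parent
     must follow j. *)
  move: nodes_sorted; rewrite -[nodes m]revK E rev_cat rev_cons -cats1 -catA.
  rewrite pairwise_cat allrel_catr => /andP[/andP[/allrelP tj _] _].
  have := tj i (Some j); rewrite mem_rev it inE eqxx => /(_ isT isT).
  by move=> /node_lt_asym; rewrite ji.
by rewrite node_ltxx.
Qed.

End computation_graph.

(** * Componentwise estimates in finite direct sums *)

Section direct_sum.
Variables (R : realType) (I : finType) (W : I -> hilbertType R).

Lemma norm_dsum_le (x : dsum W) : `|x| <= \sum_i `|x i|.
Proof.
have s0 : 0 <= \sum_i `|x i| by apply: sumr_ge0 => i _.
rewrite -(@ler_pXn2r _ 2)// ?nnegrE// {1}/Num.norm /= sqr_sqrtr; last first.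
  by apply: sumr_ge0 => i _; exact: sqr_ge0.
rewrite [leRHS]expr2 mulr_suml; apply: ler_sum => i _.
rewrite expr2 ler_wpM2l// (bigD1 i)//= lerDl.
by apply: sumr_ge0 => k _.
Qed.

Lemma littleo_dsum (F : filter_on R) (f : R -> dsum W) (k : R -> R^o) :
  (forall i, (fun e => f e i) =o_F k) -> f =o_F k.
Proof.
move=> fk; apply/eqoP => eps eps0.
(* Adding 1 to the number of components keeps the divisor positive when there are none, as for a
   node without parents. *)
have eps'0 : 0 < eps / #|I|.+1%:R by rewrite divr_gt0.
have : \forall e \near F, forall i, `|f e i| <= eps / #|I|.+1%:R * `|k e|.
  by apply: filter_forall => i; have /eqoP := fk i; exact.
apply: filterS => e fe; apply: (le_trans (norm_dsum_le _)).
apply: (le_trans (ler_sum _ (fun i _ => fe i))).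
rewrite sumr_const -[leLHS]mulr_natr.
rewrite [leLHS](_ : _ = eps * `|k e| * (#|I|%:R / #|I|.+1%:R)); last by ring.
rewrite ler_piMr ?mulr_ge0 ?(ltW eps0)// ler_pdivrMr// mul1r ler_nat.
by rewrite leqnSn.
Qed.

End direct_sum.

(** * Continuous linear maps on closed spans in L^2(P) *)

Section continuous_linear_maps.
Context {d} {Z : measurableType d} {R : realType} {P : probability Z R}.

(** Everything is relative to A because the derivatives of the primitives are controlled only on
    tangent spaces and may be arbitrary elsewhere. *)
Definition linear_continuous_map (T : normedModType R) (A : set (L2 P))
    (f : L2 P -> T) : Prop :=
  (forall a s s', A s -> A s' -> f (a *: s + s') = a *: f s + f s') /\
  (forall s, A s -> forall e : R, 0 < e -> exists2 r : R, 0 < r &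
     forall s', A s' -> L2norm (s' - s) < r -> `|f s' - f s| < e).

Lemma L2norm0 : L2norm (0 : L2 P) = 0.
Proof.
rewrite /L2norm (_ : EFin \o _ = cst 0%E) ?Lnorm0//.
Qed.

Lemma L2normB (f g : L2 P) : L2norm (f - g) = L2norm (g - f).
Proof. by rewrite -opprB; exact: LnormrN. Qed.

Lemma sub_L2closure (A : set (L2 P)) : A `<=` L2closure A.
Proof. by move=> f Af e e0; exists f => //; rewrite subrr L2norm0. Qed.

Lemma lspan_cons (E : lmodType R) (S : set E) a x y :
  S x -> lspan S y -> lspan S (a *: x + y).
Proof.
move=> Sx [n [b [z [Sz ->]]]].
exists n.+1, (fun i => oapp b a (unlift ord0 i)), (fun i => oapp z x (unlift ord0 i)).
split=> [i|]; first by case: unliftP => [j|] _ /=.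
rewrite big_ord_recl unlift_none /=; congr (_ + _).
by apply: eq_bigr => i _; rewrite liftK.
Qed.

Lemma lspan_ind (E : lmodType R) (S Q : set E) : Q 0 ->
  (forall a x y, S x -> lspan S y -> Q y -> Q (a *: x + y)) -> lspan S `<=` Q.
Proof.
move=> Q0 QS x [n [a [y [Sy ->]]]]; elim: n a y Sy => [|n IHn] a y Sy.
  by rewrite big_ord0.
rewrite big_ord_recl; apply: QS => //; last by apply: IHn.
by exists n, (fun i => a (lift ord0 i)), (fun i => y (lift ord0 i)).
Qed.

(** Linearity carries the span into the span, and continuity then carries limits to limits. Applied
    to scores, it places the derivatives at the parents in the tangent space of the next
    primitive. *)
Lemma linear_continuous_map_closure (T : hilbertType R) (S : set (L2 P))
    (S' : set T) (f : L2 P -> T) :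
  linear_continuous_map (L2closure (lspan S)) f ->
  (forall s, S s -> S' (f s)) ->
  forall s, L2closure (lspan S) s -> closure (lspan S') (f s).
Proof.
move=> [flin fcont] fS.
have lspan0 : lspan S 0.
  by exists 0, (fun=> 0), (fun=> 0); split=> [[]//|]; rewrite big_ord0.
have fspan : lspan S `<=` [set s | lspan S' (f s)].
  apply: lspan_ind => [|a x y Sx Sy fy] /=.
    (* Additivity gives f 0 = f 0 + f 0, hence f 0 = 0. *)
    have := flin 1 0 0 (sub_L2closure lspan0) (sub_L2closure lspan0).
    rewrite !scale1r addr0 -[LHS]addr0 => /addrI <-.
    by exists 0, (fun=> 0), (fun=> 0); split=> [[]//|]; rewrite big_ord0.
  have Sx' : lspan S x by rewrite -[x]addr0 -[x]scale1r; exact: lspan_cons.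
  rewrite flin; [|exact: sub_L2closure..].
  exact: (lspan_cons a (fS x Sx) fy).
move=> s As B /nbhs_ballP[e /= e0 eB].
have [r r0 fr] := fcont s As e e0.
have [s' Ss' ss'] := As r r0.
exists (f s'); split; first exact: fspan.
apply: eB; rewrite -ball_normE /ball_ /= distrC; apply: fr; first exact: sub_L2closure.
by rewrite L2normB.
Qed.

Lemma linear_continuous_map_dsum (I : finType) (W : I -> hilbertType R)
    (A : set (L2 P)) (f : L2 P -> dsum W) :
  (forall i, linear_continuous_map A (fun s => f s i)) ->
  linear_continuous_map A f.
Proof.
move=> fi; split=> [a s s' As As'|s As e e0].
  by apply: functional_extensionality_dep => i; exact: (fi i).1.
have e'0 : 0 < e / #|I|.+1%:R by rewrite divr_gt0.
have /choice[r rP] : forall i, exists r : R, 0 < r /\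
    forall s', A s' -> L2norm (s' - s) < r -> `|f s' i - f s i| < e / #|I|.+1%:R.
  by move=> i; have [r r0 rP] := (fi i).2 s As _ e'0; exists r.
(* The smallest of the finitely many radii; the default 1 keeps it positive when there are no
   components. *)
exists (\big[Order.min/1]_i r i).
  by apply: lt_bigmin => // i _; exact: (rP i).1.
move=> s' As' s's; apply: (le_lt_trans (norm_dsum_le _)).
have le_e i : `|f s' i - f s i| <= e / #|I|.+1%:R.
  by apply/ltW/(rP i).2 => //; apply: lt_le_trans s's _; exact: bigmin_le.
apply: (le_lt_trans (ler_sum _ (fun i _ => le_e i))).
rewrite sumr_const -[ltLHS]mulr_natr mulrAC -mulrA gtr_pMr// ltr_pdivrMr//.
by rewrite mul1r ltr_nat.
Qed.

End continuous_linear_maps.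

(** * The chain rule along the graph *)

Section chain_rule.
Context {d} {Z : measurableType d} {R : realType}.
Variables (M : set (probability Z R)) (P : probability Z R).
Variables (m : nat) (W : 'I_m -> hilbertType R) (pa : node m -> {set 'I_m}).
Variables (V : forall j : node m, set (ambient W j))
  (U : forall j : node m, set (parent_sum W (pa j)))
  (theta : forall j : node m,
     probability Z R -> parent_sum W (pa j) -> ambient W j).
Arguments V : clear implicits.
Arguments U : clear implicits.
Arguments theta : clear implicits.
Hypothesis MP : M P.
Hypothesis pa_lt : forall i j : 'I_m, j \in pa (Some i) -> (j < i)%N.
Hypothesis VU : forall (j : node m) (u : parent_sum W (pa j)),
  (forall i : {i : 'I_m | i \in pa j}, V (Some (val i)) (u i)) -> U j u.
Hypothesis thetaV : forall (j : node m) (Q : probability Z R)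
  (u : parent_sum W (pa j)), M Q -> U j u -> V j (theta j Q u).

Local Notation h := (forward_evaluation theta P).

Variable dtheta : forall j, L2 P -> parent_sum W (pa j) -> ambient W j.
Arguments dtheta : clear implicits.
Hypothesis dtheta_linear_continuous : forall j,
  linear_continuous_on (model_tangent_space M P)
    (tangent_space (U j) (restr h (pa j))) (dtheta j).
Hypothesis dthetaP : forall j s t, model_tangent_set M P s ->
  tangent_set (U j) (restr h (pa j)) t ->
  forall Pe ue, submodel M s Pe -> path_in (U j) (restr h (pa j)) t ue ->
    (fun e : R => theta j (Pe e) (ue e) - theta j P (restr h (pa j))
       - e *: dtheta j s t) =o_ (0^'+) (fun e : R => e : R^o).

Definition forward_derivative (s : L2 P) : forall j, ambient W j :=
  forward_pass (fun j => dtheta j s).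

Local Notation dh := forward_derivative.

Lemma forward_evaluation_mem Q j : M Q -> V j (forward_evaluation theta Q j).
Proof.
move=> MQ; elim/(node_ind pa_lt): j => j IHj.
rewrite /forward_evaluation forward_passE//; apply: thetaV => //.
by apply: VU => -[i ij]; exact: IHj.
Qed.

Lemma restr_forward_evaluation_mem Q j : M Q ->
  U j (restr (forward_evaluation theta Q) (pa j)).
Proof. by move=> MQ; apply: VU => i; exact: forward_evaluation_mem. Qed.

(** Total differentiability of [theta j] lets both arguments move. The parents' values along a
    submodel supply the second path, and their derivatives supply its direction. *)
Lemma path_in_restr s Pe j : submodel M s Pe ->
  (forall i, i \in pa j -> (fun e : R => forward_evaluation theta (Pe e) (Some i)
     - h (Some i) - e *: dh s (Some i)) =o_ (0^'+) (fun e : R => e : R^o)) ->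
  path_in (U j) (restr h (pa j)) (restr (dh s) (pa j))
    (fun e => restr (forward_evaluation theta (Pe e)) (pa j)).
Proof.
move=> [MPe _ _] diff; split=> [e e01|].
  by apply: restr_forward_evaluation_mem; exact: MPe.
by apply: littleo_dsum => -[i ij]; exact: diff.
Qed.

Lemma forward_evaluation_differentiable s Pe j : submodel M s Pe ->
  (fun e : R => forward_evaluation theta (Pe e) j - h j - e *: dh s j)
    =o_ (0^'+) (fun e : R => e : R^o).
Proof.
move=> sPe; have Ms : model_tangent_set M P s by exists Pe.
elim/(node_ind pa_lt): j => j IHj.
have pin := path_in_restr sPe IHj.
(* The path [pin] itself witnesses that its direction belongs to the tangent set. *)
have := dthetaP Ms (ex_intro _ _ pin) sPe pin.
rewrite /dh (forward_passE pa_lt (fun j => dtheta j s) j).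
rewrite /forward_evaluation (forward_passE pa_lt (fun j => theta j P) j).
by under [in X in _ -> X]eq_fun do rewrite (forward_passE pa_lt _ j).
Qed.

Lemma tangent_set_restr s j : model_tangent_set M P s ->
  tangent_set (U j) (restr h (pa j)) (restr (dh s) (pa j)).
Proof.
move=> [Pe sPe]; exists (fun e => restr (forward_evaluation theta (Pe e)) (pa j)).
by apply: path_in_restr => // i _; exact: forward_evaluation_differentiable.
Qed.

(* Linearity and continuity at the parents of j are needed to know that the
   derivatives at the parents stay in the tangent space on which [dtheta j] is
   linear and continuous: a priori this holds only along scores. *)
Lemma forward_derivative_linear_continuous j :
  linear_continuous_map (model_tangent_space M P) (fun s => dh s j).
Proof.
elim/(node_ind pa_lt): j => j IHj.
pose r s := restr (dh s) (pa j).
have dhE s : dh s j = dtheta j s (r s) by rewrite /dh forward_passE.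
have rlc : linear_continuous_map (model_tangent_space M P) r.
  by apply: linear_continuous_map_dsum => -[i ij]; exact: IHj.
have rT : forall s, model_tangent_space M P s ->
    tangent_space (U j) (restr h (pa j)) (r s).
  apply: linear_continuous_map_closure => // s; exact: tangent_set_restr.
have [dlin dcont] := dtheta_linear_continuous j.
split=> [a s s' As As'|s As e e0].
  by rewrite !dhE rlc.1// dlin//; exact: rT.
have [r1 r10 dr1] := dcont s (r s) As (rT _ As) e e0.
have [r2 r20 rr2] := rlc.2 s As r1 r10.
exists (Num.min r1 r2); first by rewrite lt_min r10.
move=> s' As'; rewrite lt_min => /andP[ss1 ss2].
by rewrite !dhE; apply: dr1 => //; [exact: rT|exact: rr2].
Qed.

Lemma pathwise_derivative_forward (psi : probability Z R -> R) :
  (forall Q, M Q -> forward_evaluation theta Q None = psi Q) ->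
  pathwise_derivative M psi (fun s => dh s None).
Proof.
move=> psiE; have [dlin dcont] := forward_derivative_linear_continuous None.
split=> // s _ Pe sPe; have [MPe _ _] := sPe.
have /eqoP diff := forward_evaluation_differentiable None sPe.
apply/eqoP => eps eps0.
(* The forward evaluation is known to equal [psi] only on M, and [Pe e] is known to be in M only for
   e in [0, 1]. *)
have e01 : \forall e \near (0 : R)^'+, 0 <= e <= 1.
  near=> e; apply/andP; split; first by apply/ltW; near: e; exact: nbhs_right_gt.
  by near: e; apply: nbhs_right_le.
apply: filterS2 e01 (diff eps eps0) => e e01.
by rewrite !psiE//; exact: MPe.
Unshelve. all: by end_near.
Qed.

End chain_rule.

(** * Root densities and change of measure *)

Section sqrt_density.
Context {d} {Z : measurableType d} {R : realType}.
Variables (mu : {sigma_finite_measure set Z -> \bar R}) (nu : probability Z R).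
Hypothesis numu : nu `<< mu.

Local Notation sd := (sqrt_density mu nu).

Let mRN : measurable_fun setT (Radon_Nikodym (charge_of_finite_measure nu) mu).
Proof.
have := @Radon_Nikodym_integrable _ _ _ (charge_of_finite_measure nu) mu numu.
exact: measurable_int.
Qed.

Lemma measurable_sqrt_density : measurable_fun setT sd.
Proof.
apply: (@measurableT_comp _ _ _ _ _ _ (@Num.sqrt R)).
  by apply: continuous_measurable_fun; exact: sqrt_continuous.
apply: (measurableT_comp (fine_measurable measurableT)).
exact: mRN.
Qed.

(** The Radon-Nikodym derivative of the charge agrees almost everywhere with the one of the measure.
    The latter is nonnegative and finite, so neither [fine] nor the square root loses anything. *)
Lemma sqr_sqrt_density_ae :
  ae_eq mu setT (fun z => (sd z ^+ 2)%:E) (Radon_Nikodym_SigmaFinite.f nu mu).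
Proof.
have := ae_eq_Radon_Nikodym_SigmaFinite numu measurableT.
apply: filterS => z /(_ I) E _.
rewrite /sqrt_density -E sqr_sqrtr ?fine_ge0 ?Radon_Nikodym_SigmaFinite.f_ge0//.
by rewrite fineK// Radon_Nikodym_SigmaFinite.f_fin_num.
Qed.

(** The product is dominated almost everywhere by |f| times the density, whose integrability is the
    change of measure for the nonnegative function |f|. *)
Lemma integrable_mul_sqrt_density (f : Z -> R) :
  nu.-integrable setT (EFin \o f) ->
  mu.-integrable setT (EFin \o (fun z => f z * sd z ^+ 2)).
Proof.
move=> intf; have mf : measurable_fun setT f by apply/measurable_EFinP/(measurable_int nu).
have mg : measurable_fun setT (Radon_Nikodym_SigmaFinite.f nu mu).
  exact: measurable_int (Radon_Nikodym_SigmaFinite.f_integrable numu).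
have mfs : measurable_fun setT (fun z => f z * sd z ^+ 2).
  by apply: measurable_funM => //; apply: measurable_funX; exact: measurable_sqrt_density.
have intabs : nu.-integrable setT (fun z => `|f z|%:E).
  exact: (integrable_abse intf).
have abs0 z : (0 <= `|f z|%:E)%E by rewrite lee_fin.
apply/integrableP; split; first exact/measurable_EFinP.
have /integrableP[_] := Radon_Nikodym_SigmaFinite.integrableM numu
  abs0 measurableT intabs.
apply: le_lt_trans; apply: ae_ge0_le_integral => //.
- by apply: measurableT_comp => //; exact/measurable_EFinP.
- apply: measurableT_comp => //; apply: emeasurable_funM => //.
  by apply/measurable_EFinP; exact: measurableT_comp.
move: sqr_sqrt_density_ae; apply: filterS => z /(_ I) /= <- _.
by rewrite lee_fin !normrM normr_id.
Qed.

Lemma Rintegral_mul_sqrt_density (f : Z -> R) :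
  nu.-integrable setT (EFin \o f) ->
  \int[mu]_z (f z * sd z ^+ 2) = \int[nu]_z f z.
Proof.
move=> intf; rewrite /Rintegral -(Radon_Nikodym_change_of_variables numu)//.
have mf : measurable_fun setT f by apply/measurable_EFinP/(measurable_int nu).
congr fine; apply: ae_eq_integral => //.
- exact: (measurable_int mu (integrable_mul_sqrt_density intf)).
- by apply: emeasurable_funM => //; exact/measurable_EFinP.
have := ae_eq_Radon_Nikodym_SigmaFinite numu measurableT.
apply: filterS2 sqr_sqrt_density_ae.
by move=> z /(_ I) <- /(_ I) <- _; rewrite EFinM.
Qed.

End sqrt_density.

(** * Scores and their L^2 limits have mean zero *)

Section mean_zero_scores.
Context {d} {Z : measurableType d} {R : realType}.
Implicit Types (P Q : probability Z R) (mu : {measure set Z -> \bar R}).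

Lemma measure_add_dominatesl P Q : P `<< measure_add P Q.
Proof.
move=> A PQA B mB BA; have := PQA B mB BA.
rewrite /= measure_addE => /eqP; rewrite padde_eq0// => /andP[/eqP + _]; exact.
Qed.

Lemma measure_add_dominatesr P Q : Q `<< measure_add P Q.
Proof.
move=> A PQA B mB BA; have := PQA B mB BA.
rewrite /= measure_addE => /eqP; rewrite padde_eq0// => /andP[_ /eqP +]; exact.
Qed.

Lemma sqr_integrable_Lfun2 mu (f : Z -> R) : measurable_fun setT f ->
  mu.-integrable setT (EFin \o (fun z => f z ^+ 2)) -> f \in Lfun mu 2%:E.
Proof.
move=> mf /integrableP[_ int2]; rewrite inE; apply/andP; split; rewrite inE//=.
rewrite /finite_norm unlock poweR_lty//; apply: le_lt_trans int2.
rewrite le_eqVlt; apply/orP; left; apply/eqP; apply: eq_integral => z _ /=.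
by rewrite powR_mulrn// -normrX.
Qed.

Lemma L2_integrable P (s : L2 P) : P.-integrable setT (EFin \o s).
Proof.
apply/Lfun1_integrable; apply: Lfun_subset12; last exact: LfunP.
by rewrite fin_num_measure.
Qed.

(* With p, q the root densities and r = q - p - (e/2) s p, integrate
   q^2 - p^2 = e s p^2 + 2 r p + ((e/2) s p + r)^2, whose left-hand side has
   integral 0. *)
Lemma qmd_mean_bound P Q (s : L2 P) (e l : R) : 0 < l ->
  `|e * \int[P]_z s z| <= (l^-1 + 2) * qmd_remainder Q s e + l
     + e ^+ 2 / 2 * \int[P]_z (s z ^+ 2).
Proof.
move=> l0; set mu := measure_add P Q.
have Pmu : P `<< mu := @measure_add_dominatesl P Q.
have Qmu : Q `<< mu := @measure_add_dominatesr P Q.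
pose p := sqrt_density mu P; pose q := sqrt_density mu Q.
pose u z := s z * p z; pose r z := q z - p z - e / 2 * u z.
have mp : measurable_fun setT p by exact: measurable_sqrt_density.
have mq : measurable_fun setT q by exact: measurable_sqrt_density.
have int1 (nu : probability Z R) : nu.-integrable setT (EFin \o cst (1 : R)).
  exact: finite_measure_integrable_cst.
have I1 (nu : probability Z R) : \int[nu]_z cst 1 z = 1 :> R.
  rewrite Rintegral_cst// mul1r -[RHS]/(fine (1%E : \bar R)); congr fine.
  exact: probability_setT.
have ints := L2_integrable s.
have ints2 : P.-integrable setT (EFin \o (fun z => s z ^+ 2)).
  by apply: Lfun2_integrable_sqr; exact: LfunP.
have p2 : mu.-integrable setT (EFin \o (fun z => p z ^+ 2)).
  have := integrable_mul_sqrt_density Pmu (int1 P).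
  by under eq_fun do rewrite /= mul1r.
have q2 : mu.-integrable setT (EFin \o (fun z => q z ^+ 2)).
  have := integrable_mul_sqrt_density Qmu (int1 Q).
  by under eq_fun do rewrite /= mul1r.
have sp2 := integrable_mul_sqrt_density Pmu ints.
have u2 : mu.-integrable setT (EFin \o (fun z => u z ^+ 2)).
  have := integrable_mul_sqrt_density Pmu ints2.
  by under eq_fun do rewrite /= -exprMn.
have Ip : \int[mu]_z (p z ^+ 2) = 1.
  have := Rintegral_mul_sqrt_density Pmu (int1 P).
  rewrite I1 => <-.
  by apply: eq_Rintegral => z _; rewrite mul1r.
have Iq : \int[mu]_z (q z ^+ 2) = 1.
  have := Rintegral_mul_sqrt_density Qmu (int1 Q).
  rewrite I1 => <-.
  by apply: eq_Rintegral => z _; rewrite mul1r.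
have Iu : \int[mu]_z (u z ^+ 2) = \int[P]_z (s z ^+ 2).
  rewrite -(Rintegral_mul_sqrt_density Pmu ints2).
  by apply: eq_Rintegral => z _; rewrite exprMn.
have Is : \int[mu]_z (s z * p z ^+ 2) = \int[P]_z s z.
  by rewrite -(Rintegral_mul_sqrt_density Pmu ints).
have muz : measurable_fun setT u by exact: measurable_funM.
have rL : r \in Lfun mu 2%:E.
  have [_ subL] := Lfun_submod_closed mu (lee1n 2).
  have -> : r = (- (e / 2)) *: (u : Z -> R) + ((-1) *: (p : Z -> R) + q).
    apply/funext => z; rewrite /r !fctE /GRing.scale /=; ring.
  by apply: (subL); [|apply: (subL)]; exact: sqr_integrable_Lfun2.
have r2 : mu.-integrable setT (EFin \o (fun z => r z ^+ 2)).
  exact: Lfun2_integrable_sqr.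
have Ir : qmd_remainder Q s e = \int[mu]_z (r z ^+ 2).
  by apply: eq_Rintegral => z _; rewrite /r mulrA.
(* [lo] integrates to 1 - 1 = 0. In [hi], the cross term 2 p r is bounded by l^-1 r^2 + l p^2, and
   the square of r + (e/2) u by 2 r^2 + (e^2/2) u^2. *)
pose lo z := q z ^+ 2 - p z ^+ 2.
pose hi z := (l^-1 + 2) * r z ^+ 2 + l * p z ^+ 2 + e ^+ 2 / 2 * u z ^+ 2.
have key z : `|e * (s z * p z ^+ 2) - lo z| <= hi z.
  have -> : e * (s z * p z ^+ 2) - lo z =
      - (2 * (p z * r z)) - (r z + e / 2 * u z) ^+ 2.
    by rewrite /lo /r /u; field.
  (* AM-GM, from the squares of r + l p and r - l p *)
  have pr : `|2 * (p z * r z)| <= l^-1 * r z ^+ 2 + l * p z ^+ 2.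
    have sq x : 0 <= l^-1 * (r z + x * (l * p z)) ^+ 2.
      by rewrite mulr_ge0 ?sqr_ge0 ?invr_ge0 ?ltW.
    have sqE x : l^-1 * (r z + x * (l * p z)) ^+ 2 =
        l^-1 * r z ^+ 2 + x * (2 * (p z * r z)) + x ^+ 2 * (l * p z ^+ 2).
      by field; rewrite gt_eqF.
    have := sq 1; have := sq (-1); rewrite !sqE sqrrN expr1n !mul1r mulN1r ler_norml.
    by lra.
  apply: (le_trans (ler_normB _ _)); rewrite normrN.
  rewrite (ger0_norm (sqr_ge0 _)) /hi.
  have := sqr_ge0 (r z - e / 2 * u z).
  by move: pr; rewrite !expr2; lra.
have intl (c : R) (f : Z -> R) : mu.-integrable setT (EFin \o f) ->
    mu.-integrable setT (EFin \o (fun z => c * f z)).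
  by move=> intf; exact: (integrableZl measurableT c intf).
have intD (f g : Z -> R) : mu.-integrable setT (EFin \o f) ->
    mu.-integrable setT (EFin \o g) ->
    mu.-integrable setT (EFin \o (fun z => f z + g z)).
  by move=> intf intg; exact: (integrableD measurableT intf intg).
have intlo : mu.-integrable setT (EFin \o lo) by exact: (integrableB measurableT q2 p2).
have inthi : mu.-integrable setT (EFin \o hi).
  by apply: (intD); [apply: (intD)|]; exact: intl.
have Ilo : \int[mu]_z lo z = 0 by rewrite RintegralB// Ip Iq subrr.
have Ihi : \int[mu]_z hi z = (l^-1 + 2) * qmd_remainder Q s e + l
     + e ^+ 2 / 2 * \int[P]_z (s z ^+ 2).
  rewrite RintegralD//; [|by apply: (intD); exact: intl|exact: intl].
  rewrite RintegralD//; [|exact: intl..].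
  by rewrite !RintegralZl// Ip mulr1 Iu Ir.
have int3 : mu.-integrable setT (EFin \o (fun z => e * (s z * p z ^+ 2) - lo z)).
  exact: (integrableB measurableT (intl e _ sp2) intlo).
have <- : \int[mu]_z (e * (s z * p z ^+ 2) - lo z) = e * \int[P]_z s z.
  by rewrite RintegralB//; [rewrite Ilo subr0 RintegralZl// Is|exact: intl].
rewrite -Ihi; apply: (le_trans (le_normr_Rintegral measurableT int3)).
apply: le_Rintegral => //; exact: (integrable_abse int3).
Qed.

(** As the remainder is o(e^2), the weight l in [qmd_mean_bound] can be small compared with e while
    the remainder divided by l is small as well. Dividing the bound by e then leaves an arbitrarily
    small number. *)
Lemma score_mean_zero (M : set (probability Z R)) P (s : L2 P) :
  model_tangent_set M P s -> \int[P]_z s z = 0.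
Proof.
move=> [Pe [_ _ /eqoP qmd]]; apply/normr0_eq0/eqP; rewrite eq_le normr_ge0 andbT.
set c := \int[P]_z s z; pose S := \int[P]_z (s z ^+ 2).
have S0 : 0 <= S by apply: Rintegral_ge0 => z _; exact: sqr_ge0.
have bound (D : R) : 0 < D <= 1 -> `|c| <= (4 + S / 2) * D.
  move=> /andP[D0 D1]; pose F : set_system R := (0 : R)^'+.
  have [e [e0 eD rem]] : exists e : R, [/\ 0 < e, e <= D &
      qmd_remainder (Pe e) s e <= D ^+ 2 * e ^+ 2].
    have Fe0 : \forall e \near F, 0 < e by exact: nbhs_right_gt.
    have FeD : \forall e \near F, e <= D by exact: nbhs_right_le.
    have Fq := qmd (D ^+ 2) (exprn_gt0 2 D0).
    have [e [/= [e0 eD] rem]] := filter_ex (filterI (filterI Fe0 FeD) Fq).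
    exists e; split => //; apply: le_trans (ler_norm _) _; apply: le_trans rem _.
    by rewrite (ger0_norm (sqr_ge0 _)).
  have Q0 : 0 <= qmd_remainder (Pe e) s e by apply: Rintegral_ge0 => z _; exact: sqr_ge0.
  have De0 : 0 < D * e by rewrite mulr_gt0.
  (* With l = D e, the terms l^-1 rem, 2 rem and l are at most D e, 2 D e and D e, which gives the
     4; the last term is at most (S/2) D e because e <= D. The bound on 2 rem uses D e <= 1. *)
  have := qmd_mean_bound (Pe e) s e De0.
  rewrite -/c -/S normrM (gtr0_norm e0) => H.
  rewrite -(ler_pM2l e0); apply: le_trans H _.
  have H1 : (D * e)^-1 * qmd_remainder (Pe e) s e <= D * e.
    by rewrite ler_pdivrMl// -expr2 exprMn.
  have H2 : qmd_remainder (Pe e) s e <= D * e.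
    apply: le_trans rem _; rewrite -exprMn expr2 ger_pMr// -[leRHS]mulr1.
    by apply: ler_pM; rewrite ?(ltW D0) ?(ltW e0) ?(le_trans eD).
  have H3 : e ^+ 2 / 2 * S <= e * D * (S / 2).
    rewrite [leLHS](_ : _ = e ^+ 2 * (S / 2)); last by ring.
    by rewrite ler_wpM2r ?divr_ge0// expr2 ler_pM2l.
  by lra.
apply/ler_addgt0Pr => eta eta0; rewrite add0r.
have K0 : 0 < 4 + S / 2 by rewrite ltr_wpDr ?divr_ge0.
apply: le_trans (bound (Num.min 1 (eta / (4 + S / 2))) _) _.
  by rewrite lt_min ltr01 divr_gt0// ge_min lexx.
by rewrite -ler_pdivlMl// mulrC ge_min lexx orbT.
Qed.

(** Hölder's inequality against the constant 1, whose L^2 norm under a probability is 1. *)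
Lemma norm_Rintegral_le_L2norm P (f : L2 P) : `|\int[P]_z f z| <= L2norm f.
Proof.
apply: (le_trans (le_normr_Rintegral measurableT (L2_integrable f))).
have h0 : (2^-1 : R) + 2^-1 = 1 by rewrite [RHS]splitr !div1r.
have mc : measurable_fun setT (cst 1 : Z -> R) by exact: measurable_cst.
have mf : measurable_fun setT (f : Z -> R) by exact: measurable_funP.
have := hoelder P mf mc (ltr0Sn R 1) (ltr0Sn R 1) h0.
rewrite Lnorm1 (_ : EFin \o cst 1 = cst 1%E)// Lnorm_cst1.
rewrite [X in (X `^ _)%E](_ : _ = 1%E); last exact: probability_setT.
rewrite poweR1r mule1 => H; rewrite /L2norm /Rintegral fine_le//.
- have := integrable_fin_num measurableT (integrable_abse (L2_integrable f)); exact.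
- by rewrite -finite_norm_fine.
by apply: le_trans H; under [leRHS]eq_integral do rewrite /= mulr1.
Qed.

(** Linearity passes from scores to their span, and the integral is continuous for the L^2
    seminorm. *)
Lemma tangent_mean_zero (M : set (probability Z R)) P (s : L2 P) :
  model_tangent_space M P s -> \int[P]_z s z = 0.
Proof.
move=> tgt.
have span0 : lspan (model_tangent_set M P) `<=`
    [set f : L2 P | \int[P]_z f z = 0].
  apply: lspan_ind => [|a x y Mx _ /= y0].
    by rewrite /= Rintegral_cst// mul0r.
  rewrite RintegralD//; [|exact: (L2_integrable (a *: x))|exact: L2_integrable].
  rewrite RintegralZl//; last exact: L2_integrable.
  by rewrite (score_mean_zero Mx) y0 mulr0 addr0.
apply/normr0_eq0/eqP; rewrite eq_le normr_ge0 andbT.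
apply/ler_addgt0Pr => e e0; rewrite add0r.
have [g /span0 /= g0 sg] := tgt e e0.
apply/ltW/le_lt_trans/sg; apply: le_trans (norm_Rintegral_le_L2norm _).
by rewrite RintegralB//; [rewrite g0 subr0|exact: L2_integrable..].
Qed.

End mean_zero_scores.

(** * Empirical integrals, non-integrable functions and stochastic order *)

Section sampling.
Context {d} {Z : measurableType d} {dO} {Omega : measurableType dO} {R : realType}.

Lemma ge0_integral_empirical (X : nat -> Omega -> Z) (n : nat) (w : Omega)
    (f : Z -> R) : (forall z, 0 <= f z) -> measurable_fun setT f ->
  (\int[empirical X n w]_z (f z)%:E = (n%:R^-1 * \sum_(i < n) f (X i w))%:E)%E.
Proof.
move=> f0 mf; have mf' : measurable_fun setT (EFin \o f) by exact/measurable_EFinP.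
have f0' z : setT z -> (0 <= (f z)%:E)%E by rewrite lee_fin.
rewrite ge0_integral_mscale// ge0_integral_measure_sum// EFinM -sumEFin.
by congr (_ * _)%E; apply: eq_bigr => i _; rewrite integral_dirac// diracT mul1e.
Qed.

Lemma Rintegral_empirical (X : nat -> Omega -> Z) (n : nat) (w : Omega)
    (f : Z -> R) : measurable_fun setT f ->
  \int[empirical X n w]_z f z = n%:R^-1 * \sum_(i < n) f (X i w).
Proof.
move=> mf; rewrite /Rintegral integralE.
rewrite -[fun z => (f z)%:E]/(EFin \o f) funerpos funerneg.
rewrite !ge0_integral_empirical//; [|exact: measurable_funrneg|exact: measurable_funrpos].
rewrite -EFinB /= -mulrBr -sumrB; congr (_ * _); apply: eq_bigr => i _.
by rewrite -[in RHS](funrposBneg f).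
Qed.

(** The positive or the negative part has infinite integral. Their difference is then infinite in
    every case, +oo - +oo being -oo by convention, and [fine] sends infinite values to 0. *)
Lemma Rintegral_not_integrable (P : probability Z R) (f : Z -> R) :
  measurable_fun setT f -> ~ P.-integrable setT (EFin \o f) ->
  \int[P]_z f z = 0.
Proof.
move=> mf nint; have mF : measurable_fun setT (EFin \o f) by exact/measurable_EFinP.
rewrite /Rintegral integralE.
set a := (\int[P]_z _)%E; set b := (\int[P]_z _)%E.
have a0 : (0 <= a)%E by apply: integral_ge0.
have b0 : (0 <= b)%E by apply: integral_ge0.
have : ~ (a < +oo /\ b < +oo)%E.
  move=> [aoo boo]; apply: nint; apply/integrableP; split => //.
  rewrite (_ : (fun _ => _) = abse \o (EFin \o f)) // fune_abse.
  rewrite ge0_integralD//; first exact: lte_add_pinfty.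
    exact: measurable_funepos.
  exact: measurable_funeneg.
by case: a b a0 b0 => [a| |] [b| |] //= _ _; case; split; rewrite ?ltry.
Qed.

(* If [f] is not integrable, neither is [f - g], and both integrals are the
   junk value 0. *)
Lemma RintegralB_mean_zero (P : probability Z R) (f g : Z -> R) :
  measurable_fun setT f -> P.-integrable setT (EFin \o g) ->
  \int[P]_z g z = 0 -> \int[P]_z (f z - g z) = \int[P]_z f z.
Proof.
move=> mf intg g0.
have [intf|nintf] := pselect (P.-integrable setT (EFin \o f)).
  by rewrite RintegralB// g0 subr0.
have mg : measurable_fun setT g by apply/measurable_EFinP/(measurable_int P).
rewrite !Rintegral_not_integrable//; first exact: measurable_funB.
apply: contra_not nintf => intfg.
have := integrableD measurableT intfg intg.
by apply: eq_integrable => // z _ /=; rewrite -EFinD subrK.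
Qed.

(** When |X + Y| exceeds e r, either |X| or |Y| exceeds (e/2) r. The outer probability is monotone
    and subadditive on arbitrary sets, which is enough for the squeeze. *)
Lemma little_opD (Pr : probability Omega R) (X Y : nat -> Omega -> R) r :
  little_op Pr X r -> little_op Pr Y r ->
  little_op Pr (fun n w => X n w + Y n w) r.
Proof.
move=> Xr Yr e e0; have e20 : 0 < e / 2 by rewrite divr_gt0.
pose A n := [set w | e / 2 * r n < `|X n w|].
pose B n := [set w | e / 2 * r n < `|Y n w|].
have AB0 : (mu_ext Pr (A n) + mu_ext Pr (B n))%E @[n --> \oo] --> (0%E : \bar R).
  by rewrite -[X in _ --> X]adde0; apply: cvgeD => //; [exact: Xr|exact: Yr].
have AB : \forall n \near \oo, (cst 0 n <=
    mu_ext Pr [set w | (e * r n < `|X n w + Y n w|)%R] <=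
    mu_ext Pr (A n) + mu_ext Pr (B n))%E.
  apply: nearW => n; apply/andP; split; first exact: mu_ext_ge0.
  apply: le_trans (outer_measureU2 _ (A n) (B n)).
  apply: le_mu_ext => w /= eXY.
  have [eX|Xe] := ltP (e / 2 * r n) `|X n w|; first by left.
  right; rewrite /B /=; have := ler_normD (X n w) (Y n w).
  move: eXY Xe; rewrite [in X in X -> _](splitr e) mulrDl; lra.
exact: squeeze_cvge AB _ (cvg_cst _) AB0.
Qed.

(** A limit ignores the sample size 0, where compatibility of the estimates is not assumed. *)
Lemma eq_little_op (Pr : probability Omega R) (X Y : nat -> Omega -> R) r :
  (forall n w, (0 < n)%N -> X n w = Y n w) -> little_op Pr X r -> little_op Pr Y r.
Proof.
move=> XY Xr e e0; apply: cvg_trans (Xr e e0); apply: near_eq_cvg.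
near=> n; congr (mu_ext Pr _); apply/seteqP; split => w /=;
  by rewrite XY//; near: n; exists 1.
Unshelve. all: by end_near.
Qed.

End sampling.

(** * Pathwise differentiability and asymptotic linearity of the estimator *)

Theorem theorem2 (R : realType) (d : measure_display) (Z : measurableType d)
  (M : set (probability Z R)) (P : probability Z R) (psi : probability Z R -> R)
  (* primitives *)
  (m : nat) (W : 'I_m -> hilbertType R) (pa : node m -> {set 'I_m})
  (V : forall j : node m, set (ambient W j))
  (U : forall j : node m, set (parent_sum W (pa j)))
  (theta : forall j : node m,
     probability Z R -> parent_sum W (pa j) -> ambient W j)
  (* sample *)
  (dO : measure_display) (Omega : measurableType dO) (Pr : probability Omega R)
  (X : nat -> Omega -> Z)
  (* estimation algorithm *)
  (I : forall n : nat, {set 'I_n})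
  (hest : forall n : nat, ({i : 'I_n | i \in I n} -> Z) ->
     forall j : node m, parent_sum W (pa j) -> ambient W j)
  (vest : forall n : nat, ({i : 'I_n | i \in I n} -> Z) ->
     forall j : node m, ambient W j -> (Z -> R) * parent_sum W (pa j)) :
  M P ->
  (forall i j : 'I_m, j \in pa (Some i) -> (j < i)%N) ->
  (forall (j : node m) (u : parent_sum W (pa j)),
     (forall i : {i : 'I_m | i \in pa j}, V (Some (val i)) (u i)) -> U j u) ->
  (forall (j : node m) (Q : probability Z R) (u : parent_sum W (pa j)),
     M Q -> U j u -> V j (theta j Q u)) ->
  (forall Q : probability Z R,
     M Q -> forward_evaluation theta Q None = psi Q) ->
  let h := forward_evaluation theta P in
  (forall j : node m, totally_pathwise_differentiable M P (U j) (theta j)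
     (restr h (pa j))) ->
  independent_draws Pr P X ->
  let data (n : nat) (w : Omega) :=
    fun i : {i : 'I_n | i \in I n} => X (val (val i)) w in
  let hhat (n : nat) (w : Omega) := forward_pass (hest n (data n w)) in
  let fhat (n : nat) (w : Omega) := backward_pass 1 (vest n (data n w)) in
  let vhat (n : nat) (w : Omega) (j : node m) :=
    vest n (data n w) j ((fhat n w).2 j) in
  (forall (n : nat) (w : Omega) (j : node m), (0 < n)%N ->
     compatible M (theta j) (vhat n w j).1 (hhat n w j)
       (restr (hhat n w) (pa j))) ->
  let fhat0 (n : nat) (w : Omega) : Z -> R := (fhat n w).1 in
  let psihat (n : nat) (w : Omega) : R :=
    hhat n w None + n%:R^-1 * \sum_(i < n) fhat0 n w (X i w) in
  let Rn (n : nat) (w : Omega) : R :=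
    hhat n w None + \int[P]_z fhat0 n w z - psi P in
  let rate (n : nat) : R := (Num.sqrt n%:R)^-1 in
  pathwise_differentiable M P psi /\
  forall f0 : L2 P, efficient_influence_function M psi f0 ->
    let Dn (n : nat) (w : Omega) : R :=
      \int[empirical X n w]_z (fhat0 n w z - f0 z)
      - \int[P]_z (fhat0 n w z - f0 z) in
    little_op Pr Dn rate ->
    little_op Pr Rn rate ->
    little_op Pr
      (fun n w => psihat n w - psi P - n%:R^-1 * \sum_(i < n) f0 (X i w)) rate.
Proof.
move=> MP pa_lt VU thetaV psiE h thetaD _ data hhat fhat vhat compat fhat0 psihat Rn rate.
split.
  (* Choice turns the existence of a derivative at each node into one family of derivatives. *)
  have /all_sig[dtheta dthetaP] j := cid (thetaD j).
  exists (fun s => forward_derivative dtheta s None).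
  apply: (pathwise_derivative_forward MP pa_lt VU thetaV) psiE => j;
    by have [] := dthetaP j.
move=> f0 [dpsi [adj [_ [adjT _] f0E]]] Dn Dn0 Rn0.
have f0_mean : \int[P]_z f0 z = 0 by rewrite f0E; exact: tangent_mean_zero (adjT 1).
apply: eq_little_op (little_opD Rn0 Dn0) => n w n0.
have mf0 : measurable_fun setT (f0 : Z -> R) by exact: measurable_funP.
(* Compatibility makes each increment integrable under some law of the model, hence measurable, and
   [fhat0] is a finite sum of these increments. *)
have mfhat0 : measurable_fun setT (fhat0 n w).
  apply: (backward_pass_ind pa_lt) => [|f g|j]; first exact: measurable_cst.
    exact: measurable_funD.
  have [Q [_ _ + _]] := compat n w j n0.
  by move=> /(measurable_int Q) /measurable_EFinP.
rewrite /Rn /Dn /psihat Rintegral_empirical; last exact: measurable_funB.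
rewrite RintegralB_mean_zero//; last exact: L2_integrable.
rewrite sumrB mulrBr; ring.
Qed.
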